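(* Let $G_1$ be an $r_1$-regular graph on $n_1$ vertices and $m_1$ edges, and $G_2$ be an arbitrary graph on $n_2$ vertices. Let $\lambda_1(A_\alpha(G_1))\ge\cdots\ge\lambda_{n_1}(A_\alpha(G_1))$ be the eigenvalues of $A_\alpha(G_1)$. Then for each $\alpha\in[0,1]$, \begin{multline*} \psi_{A_{\alpha}(G_1 \langle \mathrm{e} \rangle G_2)}(x) =\big(x-2\alpha -\alpha n_2\big)^{m_1 -n_1} \cdot \psi_{A_{\alpha}(G_2)}(x- \alpha m_1)\\ \cdot \prod_{i=2}^{n_1}\Big(x^2 -\big(2\alpha +\alpha r_1+\alpha n_2 + \lambda_i\big(A_{\alpha}(G_1)\big)\big)x + {\alpha}^2 r_1 n_2 +3\alpha r_1 -r_1 - (1- 3\alpha-\alpha n_2)\lambda_i\big(A_{\alpha}(G_1)\big)\Big)\\ \cdot \Big( x^2 -(2\alpha +\alpha r_1 +\alpha n_2 +r_1)x + {\alpha}^2 r_1 n_2 +6\alpha r_1 -2r_1 + \alpha r_1 n_2 -m_1(1-\alpha)^2(x-\alpha r_1 -r_1) \Gamma_{A_{\alpha}(G_2)}(x-\alpha m_1) \Big). \end{multline*}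
   Context: All graphs are simple, undirected, finite and connected. For a graph $G$ with adjacency matrix $A(G)$ and diagonal degree matrix $D(G)$, and $\alpha\in[0,1]$, $A_{\alpha}(G)=\alpha D(G)+(1-\alpha)A(G)$. For a square matrix $M$ of order $n$, $\psi_M(x)=\det(xI_n-M)$, and $\Gamma_M(x)=\mathbf{1}_n^T(xI_n-M)^{-1}\mathbf{1}_n$, where $\mathbf{1}_n$ is the all-ones column vector. The $R$-graph $\mathcal{R}(G)$ of $G$ is obtained from $G$ by adding, for each edge $e$ of $G$, a new vertex $u_e$ adjacent to both end vertices of $e$ (the edges of $G$ are kept). The $R$-edge join $G_1 \langle \mathrm{e} \rangle G_2$ is the graph obtained from $\mathcal{R}(G_1)$ and $G_2$ by joining every inserted vertex $u_e$ of $\mathcal{R}(G_1)$ with every vertex of $G_2$. The identity is an identity of rational functions in $x$ (the exponent $m_1-n_1$ may be negative). *)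

(* Defs.v *)
From HB Require Import structures.
From mathcomp Require Import all_boot all_order all_algebra.
From mathcomp Require Import reals complex.

Set Implicit Arguments.
Unset Strict Implicit.
Unset Printing Implicit Defensive.

Import Order.TTheory GRing.Theory Num.Theory.
Local Open Scope ring_scope.

Record sgraph := SGraph {
  vertex : finType;
  adj : rel vertex;
  adj_sym : symmetric adj;
  adj_irr : irreflexive adj }.

Definition connected (G : sgraph) : Prop :=
  (0 < #|vertex G|)%N /\ forall u v : vertex G, connect (@adj G) u v.

Definition deg (G : sgraph) (v : vertex G) : nat := #|[set w | adj v w]|.

Definition regular (G : sgraph) (r : nat) : Prop :=
  forall v : vertex G, deg v = r.

Definition edges (G : sgraph) : {set {set vertex G}} :=
  [set [set p.1; p.2] | p : vertex G * vertex G & adj p.1 p.2].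

(* The inserted vertex u_e is [inr e]. *)
Definition Rvertex (G : sgraph) : finType :=
  (vertex G + {e : {set vertex G} | e \in edges G})%type.

Definition Radj (G : sgraph) : rel (Rvertex G) := fun x y =>
  match x, y with
  | inl u, inl v => adj u v
  | inl u, inr e | inr e, inl u => u \in val e
  | inr _, inr _ => false
  end.

Lemma Radj_sym (G : sgraph) : symmetric (@Radj G).
Proof. by move=> [u|e] [v|f] //=; rewrite adj_sym. Qed.

Lemma Radj_irr (G : sgraph) : irreflexive (@Radj G).
Proof. by move=> [u|e] //=; rewrite adj_irr. Qed.

Definition Rgraph (G : sgraph) : sgraph :=
  SGraph (@Radj_sym G) (@Radj_irr G).

Definition is_inserted (G : sgraph) (x : vertex (Rgraph G)) : bool :=
  if x is inr _ then true else false.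

Definition ejoin_adj (G1 G2 : sgraph) : rel (vertex (Rgraph G1) + vertex G2) :=
  fun x y =>
  match x, y with
  | inl u, inl v => adj u v
  | inr u, inr v => adj u v
  | inl u, inr _ | inr _, inl u => is_inserted u
  end.

Lemma ejoin_adj_sym (G1 G2 : sgraph) : symmetric (@ejoin_adj G1 G2).
Proof. by move=> [u|u] [v|v]; rewrite /ejoin_adj // adj_sym. Qed.

Lemma ejoin_adj_irr (G1 G2 : sgraph) : irreflexive (@ejoin_adj G1 G2).
Proof. by move=> [u|u]; rewrite /ejoin_adj adj_irr. Qed.

Definition ejoin (G1 G2 : sgraph) : sgraph :=
  SGraph (@ejoin_adj_sym G1 G2) (@ejoin_adj_irr G1 G2).

Section Matrices.
Variable R : realType.

Definition adjmx (G : sgraph) : 'M[R]_#|vertex G| :=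
  \matrix_(i, j) (adj (enum_val i) (enum_val j))%:R.

Definition degmx (G : sgraph) : 'M[R]_#|vertex G| :=
  diag_mx (\row_i (deg (enum_val i))%:R).

Definition Aalpha (alpha : R) (G : sgraph) : 'M[R]_#|vertex G| :=
  alpha *: degmx G + (1 - alpha) *: adjmx G.

(* [s] lists the eigenvalues of [M], repeated according to multiplicity, in
   nonincreasing order: lambda_i is [s`_(i - 1)]. *)
Definition spectrum n (M : 'M[R]_n) (s : seq R) : Prop :=
  sorted >=%R s /\ char_poly M = \prod_(z <- s) ('X - z%:P).

Definition ratfun := {fraction {poly R}}.

Definition rconst (c : R) : ratfun := FracField.tofrac (c%:P).

Definition rvar : ratfun := FracField.tofrac ('X : {poly R}).

(* [psi M] and [Gamma M] are evaluated at a rational function [y], so that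
   [psi M rvar] is psi_M(x) and [psi M (rvar - c)] is psi_M(x - c). *)
Definition psi n (M : 'M[R]_n) (y : ratfun) : ratfun :=
  \det (y%:M - map_mx rconst M).

Definition Gamma n (M : 'M[R]_n) (y : ratfun) : ratfun :=
  ((const_mx 1 : 'rV_n) *m invmx (y%:M - map_mx rconst M)
     *m (const_mx 1 : 'cV_n)) 0 0.

End Matrices.

Arguments rvar {R}.

Lemma spectrum_exists (R : realType) n (M : 'M[R]_n) :
  M^T = M -> exists s, spectrum M s.
Proof.
move=> symM; pose C := map_mx (real_complex R) M.
have herm : C \is hermsymmx.
  apply/is_hermitianmxP; rewrite expr0 scale1r; apply/matrixP => i j.
  by rewrite !mxE -[in RHS]symM mxE; apply/esym/CrealP/complex_realP; eexists.
have /orthomx_spectralP := hermitian_normalmx herm.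
have /mxOverP := hermitian_spectral_diag_real herm.
set d := spectral_diag C; set P := spectralmx C => dR CE.
have uP : P \in unitmx by apply: spectral_unit.
pose s := [seq complex.Re (d 0 i) | i : 'I_n].
exists (sort >=%R s); split; first by apply: sort_sorted => x y; apply: le_total.
apply: (map_poly_inj (real_complex R)); rewrite map_char_poly -/C.
have -> : char_poly C = char_poly (diag_mx d).
  pose Q := map_mx (@polyC _) P; pose Qi := map_mx (@polyC _) (invmx P).
  have QiQ : Qi *m Q = 1%:M by rewrite -map_mxM mulVmx // map_mx1.
  rewrite /char_poly; have -> : char_poly_mx C = Qi *m char_poly_mx (diag_mx d) *m Q.
    rewrite /char_poly_mx mulmxBr mulmxBl -!map_mxM -CE.
    by rewrite mul_mx_scalar -scalemxAl QiQ scalemx1.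
  by rewrite !det_mulmx mulrAC -det_mulmx QiQ det1 mul1r.
rewrite (perm_big s) ?perm_sort //= char_poly_trig; last exact: diag_mx_is_trig.
rewrite /s big_image /= rmorph_prod; apply: eq_bigr => i _.
by rewrite rmorphB /= map_polyX map_polyC /= RRe_real ?dR // !mxE eqxx mulr1n.
Qed.

(* Main.v *)
From HB Require Import structures.
Require Import Defs.
From mathcomp Require Import all_boot all_order all_fingroup all_algebra.
From mathcomp Require Import reals ring.
Import Order.TTheory GRing.Theory Num.Theory.
Local Open Scope ring_scope.

Set Implicit Arguments.
Unset Strict Implicit.
Unset Printing Implicit Defensive.

(* Ordering the vertices as old, inserted and G2 vertices, x - A_alpha is a
   3 x 3 block matrix.  The Schur complement of its G2 block leaves a 2 x 2
   block matrix M minus a multiple of e e^T, with e the indicator vector of the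
   inserted vertices.  As G1 is regular, M w = e has an explicit solution w that
   is constant on each block, so the rank one term only contributes the factor
   1 - (1 - alpha)^2 Gamma e^T w.  A second Schur complement, with
   B B^T = r1 + A(G1) for the incidence matrix B, makes det M a product over the
   eigenvalues of A_alpha(G1).  Their largest one is r1, as the constant vector
   is an eigenvector and A_alpha(G1) has nonnegative entries; its factor
   combines with the rank one term into the last factor of the formula. *)

Local Notation one n := (const_mx 1 : 'cV_n).

(** * Determinants of block matrices *)

Lemma det_block_schur (F : fieldType) m n (A : 'M[F]_m) (B : 'M_(m, n))
    (C : 'M_(n, m)) (D : 'M_n) : D \in unitmx ->
  \det (block_mx A B C D) = \det D * \det (A - B *m invmx D *m C).
Proof.
move=> uD.
have -> : block_mx A B C D =
    block_mx 1%:M (B *m invmx D) 0 1%:M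
      *m block_mx (A - B *m invmx D *m C) 0 C D.
  by rewrite mulmx_block !mul1mx !mul0mx !add0r subrK mulmxKV.
by rewrite det_mulmx det_ublock det_lblock !det1 !mul1r mulrC.
Qed.

(** Both sides are the determinant of the block matrix with identity diagonal blocks and
    off-diagonal blocks [A] and [B], found by eliminating one diagonal block or the other. *)
Lemma det1B_mulmxC (F : fieldType) m n (A : 'M[F]_(m, n)) (B : 'M_(n, m)) :
  \det (1%:M - A *m B) = \det (1%:M - B *m A).
Proof.
have := @det_block_schur F m n 1%:M A B 1%:M (unitmx1 _ _).
have -> : block_mx 1%:M A B 1%:M =
    block_mx 1%:M 0 B 1%:M *m block_mx 1%:M A 0 (1%:M - B *m A).
  by rewrite mulmx_block !mul1mx !mul0mx !mulmx1 !addr0 addrC subrK.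
by rewrite det_mulmx det_ublock det_lblock !det1 !mul1r invmx1 mulmx1 => ->.
Qed.

(** The sign of the permutation enters once for the rows and once for the columns, so it cancels.
    The sizes stay distinct because those of the application are only provably equal. *)
Lemma det_mxsub_bij (R : comNzRingType) n k (g : 'I_n -> 'I_k) (M : 'M[R]_k) :
  bijective g -> \det (mxsub g g M) = \det M.
Proof.
move=> bg; have := bij_eq_card bg; rewrite !card_ord => e; subst k.
have -> : mxsub g g M = row_perm (perm (bij_inj bg)) (col_perm (perm (bij_inj bg)) M).
  by apply/matrixP => i j; rewrite !mxE !permE.
rewrite row_permE col_permE !det_mulmx !det_perm odd_permV mulrCA.
by rewrite -signr_addb addbb mulr1.
Qed.

(** The constant row sums make the upper left block act on vectors constant on each part through the
    2 x 2 matrix with rows [(k, - b * r)] and [(- 2 * b, c)], whose determinant is [D]. *)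
Lemma det_two_join (F : fieldType) p q s (P : 'M[F]_p) (B : 'M_(p, q))
    (C : 'M_s) (b c k r : F) (D := c * k - 2 * b ^+ 2 * r) :
    C \in unitmx -> c != 0 -> D != 0 ->
    P *m one p = k *: one p -> B *m one q = r *: one p ->
    B^T *m one p = 2 *: one q ->
  \det (block_mx (block_mx P (- b *: B) (- b *: B^T) c%:M)
          (col_mx 0 (const_mx (- b))) (row_mx 0 (const_mx (- b))) C) =
  \det C * (c ^+ q / c ^+ p) * \det (c *: P - b ^+ 2 *: (B *m B^T))
  * (1 - b ^+ 2 * q%:R * k / D * ((one s)^T *m invmx C *m one s) 0 0).
Proof.
move=> uC c0 D0 P1 B1 BT1.
set g := (_ *m one s) 0 0; set M := block_mx P _ _ _.
pose e : 'cV[F]_(p + q) := col_mx 0 (one q).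
(* Cramer's rule for that 2 x 2 matrix, with right-hand side [(0, 1)], gives the two values of
   [w]. *)
pose w : 'cV[F]_(p + q) := col_mx ((b * r / D) *: one p) ((k / D) *: one q).
have Mw : M *m w = e.
  rewrite mul_block_col mul_scalar_mx -!scalemxAr -!scalemxAl P1 B1 BT1 !scalerA.
  rewrite -!scalerDl (_ : _ + _ = 0); last by field.
  rewrite (_ : _ + _ = 1); last by rewrite /D; field.
  by rewrite scale0r scale1r.
have ew : e^T *m w = (q%:R * k / D)%:M.
  rewrite tr_col_mx mul_row_col trmx0 mul0mx add0r -scalemxAr.
  apply/matrixP => i j; rewrite !ord1 !mxE eqxx mulr1n.
  under eq_bigr do rewrite !mxE mulr1.
  by rewrite sumr_const card_ord; ring.
rewrite det_block_schur // -!mulrA; congr (_ * _).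
have -> : col_mx 0 (const_mx (- b)) = - b *: (e *m (one s)^T).
  rewrite mul_col_mx mul0mx scale_col_mx scaler0; congr col_mx.
  by apply/matrixP => i j; rewrite !mxE big_ord1 !mxE; ring.
have -> : row_mx 0 (const_mx (- b)) = - b *: (one s *m e^T).
  rewrite tr_col_mx mul_mx_row trmx0 mulmx0 scale_row_mx scaler0; congr row_mx.
  by apply/matrixP => i j; rewrite !mxE big_ord1 !mxE; ring.
(* Since [M *m w = e], [M] factors out of the rank one update; the determinant of the other factor
   then collapses to a 1 x 1 one. *)
have -> : M - (- b *: (e *m (one s)^T)) *m invmx C *m (- b *: (one s *m e^T)) =
    M *m (1%:M - (b ^+ 2 * g) *: w *m e^T).
  rewrite mulmxBr mulmx1 mulmxA -[in RHS]scalemxAr Mw -!scalemxAl -!scalemxAr.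
  rewrite !scalerA mulrNN -expr2 -[in RHS]scalerA; congr (_ - _ *: _).
  have -> : e *m (one s)^T *m invmx C *m (one s *m e^T) =
      e *m ((one s)^T *m invmx C *m one s) *m e^T by rewrite !mulmxA.
  rewrite [X in e *m X](_ : _ = g%:M) ?mul_mx_scalar -?scalemxAl //.
  by apply/matrixP => i j; rewrite !ord1 [RHS]mxE.
rewrite det_mulmx det1B_mulmxC -scalemxAr ew det_mx11 !mxE eqxx !mulr1n.
rewrite !mulrA; congr (_ * _); last by congr (_ - _); ring.
(* Eliminating the scalar block gives [c ^+ q]; clearing [c^-1] from a complement of size [p] gives
   the division by [c ^+ p]. *)
rewrite det_block_schur ?unitmxE ?det_scalar ?unitfE ?expf_neq0 //.
rewrite -mulrA; congr (_ * _).
rewrite invmx_scalar mul_mx_scalar -!scalemxAl -scalemxAr !scalerA.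
have -> : P - (c^-1 * - b * - b) *: (B *m B^T)
  = c^-1 *: (c *: P - b ^+ 2 *: (B *m B^T)).
  rewrite scalerBr !scalerA mulVf // scale1r; congr (_ - _ *: _); ring.
by rewrite detZ exprVn.
Qed.

(** * Split characteristic polynomials and the largest eigenvalue *)

Lemma det_map_split (R S : comNzRingType) (f : {rmorphism R -> S}) n
    (M : 'M[R]_n) (s : seq R) (y : S) :
  char_poly M = \prod_(z <- s) ('X - z%:P) ->
  \det (y%:M - map_mx f M) = \prod_(z <- s) (y - f z).
Proof.
(* Evaluation at [y] with coefficients sent through [f] is a ring morphism, so it commutes with the
   determinant and carries the factorization over. *)
move=> Ms; pose h : {rmorphism {poly R} -> S} := horner_morph (fun a => mulrC y (f a)).
have -> : y%:M - map_mx f M = map_mx h (char_poly_mx M).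
  apply/matrixP => i j; rewrite !mxE rmorphB rmorphMn /=.
  by rewrite /h horner_morphX horner_morphC.
rewrite det_map_mx -/(char_poly M) Ms rmorph_prod; apply: eq_bigr => z _.
by rewrite rmorphB /= /h horner_morphX horner_morphC.
Qed.

Lemma spectrum_size (R : realType) n (M : 'M[R]_n) s :
  spectrum M s -> size s = n.
Proof.
case=> _ /(congr1 (size \o polyseq)) /=.
by rewrite size_char_poly size_prod_XsubC => -[].
Qed.

(** A Perron argument. Eigenvectors are row vectors here, so equal column sums make the constant
    vector one; nonnegative entries bound every eigenvalue by [r]. *)
Lemma spectrum_head (R : realType) n (M : 'M[R]_n) (r : R) s :
    (0 < n)%N -> (forall i j, 0 <= M i j) -> (forall j, \sum_i M i j = r) ->
  spectrum M s -> s`_0 = r.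
Proof.
move=> n0 M0 Mr Ms; have [srt Mp] := Ms.
have mem a : (a \in s) = eigenvalue M a.
  by rewrite eigenvalue_root_char Mp root_prod_XsubC.
have rs : r \in s.
  rewrite mem; apply/eigenvalueP; exists (const_mx 1).
    apply/matrixP => i j; rewrite !mxE mulr1 -[RHS](Mr j).
    by apply: eq_bigr => k _; rewrite mxE mul1r.
  apply/eqP => /matrixP /(_ 0 (Ordinal n0)); rewrite !mxE.
  by apply/eqP/oner_neq0.
have ler a : a \in s -> a <= r.
  rewrite mem => /eigenvalueP [v vM v0].
  (* At a coordinate [j] where [v] is largest in absolute value, [a * v 0 j] is the sum of the
     [v 0 i * M i j], hence at most [r] times [|v 0 j|]. *)
  have [j _ jmax] := @arg_maxP _ _ _ (Ordinal n0) xpredT (fun j => `|v 0 j|) isT.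
  have vj : 0 < `|v 0 j|.
    rewrite normr_gt0; apply: contra v0 => /eqP vj0; apply/eqP/rowP => k.
    by apply/eqP; rewrite mxE -normr_le0 (le_trans (jmax k isT)) // vj0 normr0.
  rewrite -(ler_pM2r vj); apply: le_trans (_ : `|a * v 0 j| <= _).
    by rewrite normrM ler_wpM2r ?ler_norm // ltW.
  move/matrixP/(_ 0 j): vM; rewrite !mxE => <-.
  apply: le_trans (ler_norm_sum _ _ _) _.
  rewrite -(Mr j) mulr_suml; apply: ler_sum => i _.
  by rewrite normrM (ger0_norm (M0 i j)) mulrC ler_wpM2l //; apply: jmax.
have ge_tr : transitive (>=%R : rel R) by move=> a b c ba cb; apply: le_trans cb ba.
case: s srt Mp Ms mem rs ler => //= a s srt _ _ _ rs ler.
apply/le_anti; rewrite ler ?mem_head //=; move: rs; rewrite inE => /predU1P[->//|rs].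
by move/allP: (order_path_min ge_tr srt) => /(_ _ rs).
Qed.

(** * Counting the edges at a vertex *)

Section GraphCounting.
Variables (G : sgraph).
Implicit Types (u v w : vertex G) (e : {set vertex G}).

Lemma sum_adj (T : nmodType) v (F : vertex G -> T) :
  \sum_(w in [set w | adj v w]) F w = \sum_w F w *+ adj v w.
Proof.
by rewrite big_mkcond; apply: eq_bigr => w _; rewrite inE; case: adj.
Qed.

Lemma degE v : deg v = (\sum_w adj v w)%N.
Proof. by rewrite /deg -sum1_card sum_adj; apply: eq_bigr => w _; case: adj. Qed.

Lemma card_edge e : e \in edges G -> #|e| = 2%N.
Proof.
case/imsetP => -[u v] /= uv ->; rewrite cards2.
by case: eqVneq uv => //= ->; rewrite inE adj_irr.
Qed.

Lemma edges_at v :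
  [set e in edges G | v \in e] = [set [set v; w] | w in [set w | adj v w]].
Proof.
apply/setP => e; rewrite inE; apply/andP/imsetP => [[/imsetP[[u w]]]|[w]].
  rewrite inE /= => uw ->; rewrite in_set2 => /pred2P[]->.
    by exists w; rewrite ?inE.
  by exists u; rewrite ?inE 1?adj_sym 1?setUC.
rewrite inE => vw ->; rewrite set21; split=> //.
by apply/imsetP; exists (v, w); rewrite ?inE.
Qed.

(** The neighbours [w] of [v] correspond to the edges [[set v; w]], injectively because there are no
    loops. *)
Lemma sum_edges_at (T : nmodType) v (F : {set vertex G} -> T) :
  \sum_(e in edges G | v \in e) F e = \sum_w F [set v; w] *+ adj v w.
Proof.
rewrite -sum_adj -(@big_imset _ _ _ _ _ (fun w => [set v; w])).
  by rewrite -edges_at; apply: eq_bigl => e; rewrite inE.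
move=> w w'; rewrite !inE => vw vw' /setP /(_ w).
rewrite !inE eqxx orbT => /esym/predU1P[E|/eqP->//].
by rewrite E adj_irr in vw.
Qed.

End GraphCounting.

(** * The vertex-edge incidence matrix *)

Local Notation edge G := ({e : {set vertex G} | e \in edges G} : finType).

Definition incmx (F : nzRingType) (G : sgraph) :
    'M[F]_(#|vertex G|, #|edge G|) :=
  \matrix_(i, j) (enum_val i \in val (enum_val j : edge G))%:R.

Lemma sum_enum_val (F : nmodType) (T : finType) (f : T -> F) :
  \sum_(i < #|T|) f (enum_val i) = \sum_x f x.
Proof. by rewrite [RHS](reindex _ (onW_bij _ (enum_val_bij T))). Qed.

Lemma card_edge_type (G : sgraph) : #|edge G| = #|edges G|.
Proof. by rewrite card_sig. Qed.

Lemma sum_edge (F : nmodType) (G : sgraph) (v : vertex G)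
    (f : {set vertex G} -> F) :
  \sum_(e : edge G) f (val e) *+ (v \in val e) = \sum_w f [set v; w] *+ adj v w.
Proof.
rewrite -sum_edges_at big_mkcondr -(big_sub (mem (edges G)) (fun e => f e *+ (v \in e))).
by apply: eq_bigr => e _; case: (_ \in _).
Qed.

Lemma sum_incidence (G : sgraph) (v : vertex G) :
  (\sum_(e : edge G) (v \in val e) = deg v)%N.
Proof.
rewrite degE; transitivity (\sum_(e : edge G) 1%N *+ (v \in val e)).
  by apply: eq_bigr => e _; case: (_ \in _).
by rewrite (@sum_edge nat G v (fun=> 1%N)); apply: eq_bigr => w _; case: adj.
Qed.

Section IncidenceMatrix.
Variables (F : comNzRingType) (G : sgraph).
Local Notation B := (incmx F G).

Lemma incmx_tr :
  B *m B^T = \matrix_(i, j) ((deg (enum_val i))%:R *+ (i == j)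
                             + (adj (enum_val i) (enum_val j))%:R).
Proof.
apply/matrixP => i j; rewrite !mxE.
set u := enum_val i; set v := enum_val j.
(* The entry counts the edges that contain both [u] and [v]. *)
have -> : \sum_k B i k * B^T k j = \sum_(e : edge G) (v \in val e)%:R *+ (u \in val e).
  rewrite -[RHS]sum_enum_val; apply: eq_bigr => k _.
  by rewrite !mxE -[RHS]mulr_natr mulrC.
rewrite (@sum_edge F G u (fun e => (v \in e)%:R)).
rewrite -(inj_eq enum_val_inj) -/u -/v.
case: (eqVneq u v) => [<-|uv].
  rewrite adj_irr addr0 mulr1n degE natr_sum; apply: eq_bigr => w _.
  by rewrite set21; case: adj.
(* The only possible edge through distinct [u] and [v] is [[set u; v]], so only [w = v]
   contributes. *)
rewrite mulr0n add0r (bigD1 v) //= set22 big1 ?addr0; last first.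
  by move=> w wv; rewrite in_set2 ![v == _]eq_sym (negPf uv) (negPf wv) mul0rn.
by case: adj.
Qed.

Lemma incmx_one r : regular G r -> B *m one _ = r%:R *: one _.
Proof.
move=> Gr; apply/matrixP => i j; rewrite !mxE mulr1 -(Gr (enum_val i)).
rewrite -sum_incidence natr_sum -[RHS]sum_enum_val.
by apply: eq_bigr => k _; rewrite !mxE mulr1.
Qed.

Lemma incmxT_one : B^T *m one _ = 2 *: one _.
Proof.
apply/matrixP => i j; rewrite !mxE mulr1.
rewrite -(card_edge (valP (enum_val i))) -sum1_card natr_sum.
rewrite [RHS]big_mkcond -[RHS]sum_enum_val.
by apply: eq_bigr => k _; rewrite !mxE mulr1; case: (_ \in _).
Qed.

End IncidenceMatrix.

(** * Degrees in the R-edge join *)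

Section EjoinDegrees.
Variables (G1 G2 : sgraph).

(** Each edge at [v] gives two neighbours, its other end and its inserted vertex. *)
Lemma deg_ejoin_old (v : vertex G1) :
  deg (inl (inl v) : vertex (ejoin G1 G2)) = (2 * deg v)%N.
Proof.
rewrite degE !big_sumType /= sum_incidence -degE.
by rewrite (big1_eq _ _ : \sum_i 0 = 0)%N addn0 mul2n addnn.
Qed.

Lemma deg_ejoin_inserted (e : edge G1) :
  deg (inl (inr e) : vertex (ejoin G1 G2)) = (2 + #|vertex G2|)%N.
Proof.
rewrite degE !big_sumType /= sum1_card.
rewrite (big1_eq _ _ : \sum_i 0 = 0)%N addn0; congr (_ + _)%N.
rewrite -(card_edge (valP e)) -sum1_card [RHS]big_mkcond; apply: eq_bigr => v _.
by case: (_ \in _).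
Qed.

Lemma deg_ejoin_new (w : vertex G2) :
  deg (inr w : vertex (ejoin G1 G2)) = (deg w + #|edges G1|)%N.
Proof.
rewrite degE !big_sumType /= -degE sum1_card.
by rewrite (big1_eq _ _ : \sum_i 0 = 0)%N add0n addnC -card_edge_type.
Qed.

End EjoinDegrees.

(** * Nonvanishing in the field of rational functions *)

HB.instance Definition _ (R : realType) :=
  GRing.RMorphism.copy (@rconst R) (@FracField.tofrac {poly R} \o @polyC R).

Section RationalFunctions.
Variable R : realType.

Lemma rvarB_const_neq0 (c : R) : rvar - rconst c != 0.
Proof. by rewrite /rvar /rconst -rmorphB tofrac_eq0 polyXsubC_eq0. Qed.

(** A monic polynomial of degree 2 differs from every constant. The denominator [D] of the rank one
    factor has this shape. *)
Lemma rvar_quadratic_neq0 (u v w : R) :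
  (rvar - rconst u) * (rvar - rconst v) - rconst w != 0.
Proof.
rewrite /rvar /rconst -!rmorphB -rmorphM -rmorphB tofrac_eq0 subr_eq0.
apply/eqP => /(congr1 (size \o polyseq)) /=.
rewrite size_Mmonic ?monicXsubC ?polyXsubC_eq0 // !size_XsubC size_polyC.
by case: eqP.
Qed.

(** This is the characteristic matrix of [M + c%:M], whose determinant is monic. Hence the [invmx]
    in [Gamma] is a genuine inverse. *)
Lemma charmx_unit n (M : 'M[R]_n) (c : R) :
  (rvar - rconst c)%:M - map_mx (@rconst R) M \in unitmx.
Proof.
have -> : (rvar - rconst c)%:M - map_mx (@rconst R) M =
    map_mx (@FracField.tofrac {poly R}) (char_poly_mx (M + c%:M)).
  apply/matrixP => i j; rewrite !mxE polyCD polyCMn !rmorphB !rmorphD !rmorphMn /=.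
  by rewrite /rconst /rvar mulrnBl opprD addrA addrAC.
rewrite unitmxE det_map_mx unitfE tofrac_eq0.
exact/monic_neq0/char_poly_monic.
Qed.

End RationalFunctions.

(** * Entries, symmetry and column sums of [Aalpha] *)

Lemma scalarB_mapE (R S : pzRingType) (f : R -> S) n (M : 'M[R]_n) (y : S) i j :
  (y%:M - map_mx f M) i j = y *+ (i == j) - f (M i j).
Proof. by rewrite !mxE. Qed.

Section Aalpha.
Variables (R : realType) (alpha : R) (G : sgraph).
Local Notation L := (Aalpha alpha G).

Lemma AalphaE i j : L i j = alpha * ((deg (enum_val i))%:R *+ (i == j))
  + (1 - alpha) * (adj (enum_val i) (enum_val j))%:R.
Proof. by rewrite !mxE. Qed.

Lemma Aalpha_sym : L^T = L.
Proof.
apply/matrixP => i j; rewrite mxE !AalphaE adj_sym [j == i]eq_sym.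
by case: eqVneq => [->|].
Qed.

Lemma Aalpha_colsum r j : regular G r -> \sum_i L i j = r%:R.
Proof.
move=> Gr; rewrite (eq_bigr _ (fun i _ => AalphaE i j)) big_split /= -!mulr_sumr.
rewrite (bigD1 j) //= eqxx big1 => [|i /negPf->//].
rewrite mulr1n addr0 Gr (@sum_enum_val R _ (fun v => (adj v (enum_val j))%:R)).
under eq_bigr do rewrite adj_sym.
by rewrite -natr_sum -degE Gr; ring.
Qed.

Lemma Aalpha_ge0 i j : 0 <= alpha <= 1 -> 0 <= L i j.
Proof.
case/andP=> a0 a1; rewrite AalphaE addr_ge0 // mulr_ge0 ?subr_ge0 ?ler0n //.
by case: eqP => // _; rewrite ler0n.
Qed.

End Aalpha.

(** * The block form of the matrix of the join *)

Lemma split_lshift m n (i : 'I_m) : split (lshift n i) = inl i.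
Proof. exact: (unsplitK (inl i)). Qed.

Lemma split_rshift m n (i : 'I_n) : split (rshift m i) = inr i.
Proof. exact: (unsplitK (inr i)). Qed.

Section EjoinBlocks.
Variables (G1 G2 : sgraph).

Local Notation N1 := #|vertex G1|.
Local Notation M1 := #|edge G1|.
Local Notation N2 := #|vertex G2|.

(** Fixes the vertex order that produces the blocks: old, inserted, then [G2]. *)
Definition ejoin_vertex (i : 'I_(N1 + M1 + N2)) : vertex (ejoin G1 G2) :=
  match split i with
  | inl j => match split j with
             | inl k => inl (inl (enum_val k))
             | inr k => inl (inr (enum_val k))
             end
  | inr k => inr (enum_val k)
  end.

Definition ejoin_index (v : vertex (ejoin G1 G2)) : 'I_(N1 + M1 + N2) :=
  match v with
  | inl (inl u) => lshift N2 (lshift M1 (enum_rank u))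
  | inl (inr e) => lshift N2 (rshift N1 (enum_rank e))
  | inr w => rshift (N1 + M1) (enum_rank w)
  end.

Lemma ejoin_vertex_old i :
  ejoin_vertex (lshift N2 (lshift M1 i)) = inl (inl (enum_val i)).
Proof. by rewrite /ejoin_vertex !split_lshift. Qed.

Lemma ejoin_vertex_inserted i :
  ejoin_vertex (lshift N2 (rshift N1 i)) = inl (inr (enum_val i)).
Proof. by rewrite /ejoin_vertex split_lshift split_rshift. Qed.

Lemma ejoin_vertex_new i :
  ejoin_vertex (rshift (N1 + M1) i) = inr (enum_val i).
Proof. by rewrite /ejoin_vertex split_rshift. Qed.

Definition ejoin_vertexE :=
  (ejoin_vertex_old, ejoin_vertex_inserted, ejoin_vertex_new).

Lemma ejoin_vertex_bij : bijective ejoin_vertex.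
Proof.
exists ejoin_index => [i|[[u|e]|w]]; rewrite /ejoin_index ?ejoin_vertexE ?enum_rankK //.
by case: (split_ordP i) => k ->; first case: (split_ordP k) => k' ->;
  rewrite ejoin_vertexE enum_valK.
Qed.

(** Old vertices double their degree: one half completes [Aalpha alpha G1], the other shifts [y] by
    [a * r]. Each vertex of [G2] gains one neighbour per edge of [G1], which gives the shift in the
    last block. *)
Lemma psi_ejoin (R : realType) (r : nat) (alpha : R) (y : ratfun R) :
  regular G1 r ->
  let a := rconst alpha in let b := 1 - a in let B := incmx (ratfun R) G1 in
  psi (Aalpha alpha (ejoin G1 G2)) y =
  \det (block_mx
    (block_mx ((y - a * r%:R)%:M - map_mx (@rconst R) (Aalpha alpha G1)) (- b *: B)
       (- b *: B^T) (y - 2 * a - a * N2%:R)%:M)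
    (col_mx 0 (const_mx (- b))) (row_mx 0 (const_mx (- b)))
    ((y - a * #|edges G1|%:R)%:M - map_mx (@rconst R) (Aalpha alpha G2))).
Proof.
move=> reg1 a b B; rewrite /psi.
(* [g] carries the block order to the vertex enumeration that indexes [Aalpha]. *)
pose g i := enum_rank (ejoin_vertex i).
have g_bij : bijective g by apply: bij_comp ejoin_vertex_bij; apply: enum_rank_bij.
rewrite -(det_mxsub_bij _ g_bij); congr (\det _); apply/matrixP => i j.
have entry : forall (G : sgraph) k l, rconst (Aalpha alpha G k l) =
    a * (((deg (enum_val k))%:R) *+ (k == l)) + b * (adj (enum_val k) (enum_val l))%:R.
  move=> G k l; rewrite AalphaE rmorphD !rmorphM rmorphMn rmorphB rmorph1.
  by rewrite !rmorph_nat.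
rewrite mxE scalarB_mapE entry !enum_rankK (inj_eq (bij_inj g_bij)).
(* [ring] diverges if it can unfold [a] and [b] into the fraction field. *)
rewrite /B; clear B; clearbody b; clearbody a.
case: (split_ordP i) => {}i ->; [case: (split_ordP i) => {}i ->|];
 (case: (split_ordP j) => {}j ->; [case: (split_ordP j) => {}j ->|]);
 rewrite ?block_mxEul ?block_mxEur ?block_mxEdl ?block_mxEdr
   ?col_mxEu ?col_mxEd ?row_mxEl ?row_mxEr !ejoin_vertexE
   ?deg_ejoin_old ?deg_ejoin_inserted ?deg_ejoin_new ?scalarB_mapE ?entry ?mxE !eq_shift /=
   ?natrD ?natrM ?reg1;
 try case: (i == j); rewrite ?mulr1n ?mulr0n; ring.
Qed.

End EjoinBlocks.

(** * Evaluation of the block determinant for a regular [G1] *)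

Lemma charmx_Aalpha_one (R : realType) (G : sgraph) r (alpha : R) (y : ratfun R) :
  regular G r ->
  (y%:M - map_mx (@rconst R) (Aalpha alpha G)) *m one _ = (y - r%:R) *: one _.
Proof.
move=> Gr; rewrite mulmxBl mul_scalar_mx scalerBl; congr (_ - _).
apply/matrixP => i j; rewrite mxE [RHS]mxE [const_mx _ _ _]mxE mulr1.
rewrite -(rmorph_nat (@rconst R)) -(Aalpha_colsum alpha i Gr) rmorph_sum.
(* Symmetry turns the known column sums into row sums. *)
by apply: eq_bigr => k _; rewrite -{2}Aalpha_sym [_^T _ _]mxE !mxE mulr1.
Qed.

(** Replacing [b *: A] by [L - (a * r)%:M] makes the matrix [c + b] times [z%:M - L]. There is no
    division by [b], which vanishes when [alpha = 1]. *)
Lemma det_shifted_gram (F : fieldType) n (L A : 'M[F]_n) (a b c y r : F) (s : seq F) :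
    c + b != 0 -> L = (a * r)%:M + b *: A -> size s = n ->
    (forall z, \det (z%:M - L) = \prod_(l <- s) (z - l)) ->
  \det (c *: ((y - a * r)%:M - L) - b ^+ 2 *: (r%:M + A)) =
  \prod_(l <- s) (c * (y - a * r - l) - b ^+ 2 * r + a * b * r - b * l).
Proof.
move=> cb0 LE sn detL.
pose z := (c * (y - a * r) - b ^+ 2 * r + a * b * r) / (c + b).
have -> : c *: ((y - a * r)%:M - L) - b ^+ 2 *: (r%:M + A) = (c + b) *: (z%:M - L).
  rewrite LE; apply/matrixP => i j; rewrite !mxE /z.
  by case: (i == j); rewrite ?mulr1n ?mulr0n; field.
rewrite detZ detL; have -> : (c + b) ^+ n = \prod_(l <- s) (c + b).
  by rewrite big_const_seq count_predT iter_mulr_1 sn.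
by rewrite -big_split; apply: eq_bigr => l _; rewrite /z /=; field.
Qed.

Lemma map_Aalpha_regular (R : realType) (G : sgraph) r (alpha : R) :
  regular G r ->
  map_mx (@rconst R) (Aalpha alpha G) =
  (rconst alpha * r%:R)%:M + (1 - rconst alpha) *: map_mx (@rconst R) (adjmx R G).
Proof.
move=> Gr; apply/matrixP => i j; rewrite mxE AalphaE Gr !mxE rmorphD !rmorphM.
by rewrite rmorphMn rmorphB rmorph1 !rmorph_nat mulrnAr.
Qed.

Lemma incmx_tr_regular (R : realType) (G : sgraph) r : regular G r ->
  incmx (ratfun R) G *m (incmx (ratfun R) G)^T =
  r%:R%:M + map_mx (@rconst R) (adjmx R G).
Proof.
move=> Gr; rewrite incmx_tr; apply/matrixP => i j.
by rewrite !mxE Gr rmorph_nat.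
Qed.

Lemma quadraticE (F : comNzRingType) (x a r n l : F) :
  (x - 2 * a - a * n) * (x - a * r - l) - (1 - a) ^+ 2 * r + a * (1 - a) * r
    - (1 - a) * l =
  x ^+ 2 - (2 * a + a * r + a * n + l) * x
    + a ^+ 2 * r * n + 3 * a * r - r - (1 - 3 * a - a * n) * l.
Proof. by ring. Qed.

(** As [a - 1 = - b], the factor at the eigenvalue [r] is exactly the denominator of the rank one
    term, so the two can merge. *)
Lemma principal_quadraticE (F : fieldType) (x a r n : F)
    (c := x - 2 * a - a * n) (b := 1 - a) (k := x - a * r - r) :
  c * (x - a * r - r) - b ^+ 2 * r + a * b * r - b * r = c * k - 2 * b ^+ 2 * r.
Proof. by rewrite /c /b /k; ring. Qed.

Lemma principal_factorE (F : fieldType) (x a r n m g : F)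
    (c := x - 2 * a - a * n) (b := 1 - a) (k := x - a * r - r)
    (D := c * k - 2 * b ^+ 2 * r) : D != 0 ->
  D * (1 - b ^+ 2 * m * k / D * g) =
  x ^+ 2 - (2 * a + a * r + a * n + r) * x
   + a ^+ 2 * r * n + 6 * a * r - 2 * r + a * r * n
   - m * b ^+ 2 * k * g.
Proof.
move=> D0; transitivity (D - b ^+ 2 * m * k * g); first by move: D D0 => D D0; field.
by rewrite /D /c /b /k; ring.
Qed.

Lemma mulr_regroup (F : comNzRingType) (u v w y z : F) :
  u * v * (w * y) * z = v * u * y * (w * z).
Proof. by ring. Qed.

Theorem theorem4 (R : realType) (G1 G2 : sgraph) (r1 n1 m1 n2 : nat)
    (conn1 : connected G1) (conn2 : connected G2)
    (reg1 : regular G1 r1)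
    (En1 : #|vertex G1| = n1) (Em1 : #|edges G1| = m1)
    (En2 : #|vertex G2| = n2)
    (alpha : R) (alpha01 : 0 <= alpha <= 1)
    (lambda : seq R) (lambdaP : spectrum (Aalpha alpha G1) lambda) :
  let x : ratfun R := rvar in
  let a : ratfun R := rconst alpha in
  let r : ratfun R := r1%:R in
  let m : ratfun R := m1%:R in
  let n : ratfun R := n2%:R in
  let l (i : nat) : ratfun R := rconst lambda`_i in
  psi (Aalpha alpha (ejoin G1 G2)) x =
    (x - 2 * a - a * n) ^ (m1%:Z - n1%:Z)
    * psi (Aalpha alpha G2) (x - a * m)
    * (\prod_(1 <= i < n1)
         (x ^+ 2 - (2 * a + a * r + a * n + l i) * x
          + a ^+ 2 * r * n + 3 * a * r - r - (1 - 3 * a - a * n) * l i))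
    * (x ^+ 2 - (2 * a + a * r + a * n + r) * x
       + a ^+ 2 * r * n + 6 * a * r - 2 * r + a * r * n
       - m * (1 - a) ^+ 2 * (x - a * r - r)
         * Gamma (Aalpha alpha G2) (x - a * m)).
Proof.
move=> x a r m n l.
pose c := x - 2 * a - a * n; pose b := 1 - a.
have cE : c = rvar - rconst (2 * alpha + alpha * n2%:R).
  by rewrite rmorphD !rmorphM !rmorph_nat opprD addrA.
have cb0 : c + b != 0.
  have -> : c + b = rvar - rconst (2 * alpha + alpha * n2%:R - (1 - alpha)).
    by rewrite cE !rmorphB rmorph1 opprB -addrA [- _ + _]addrC.
  exact: rvarB_const_neq0.
have c0 : c != 0 by rewrite cE rvarB_const_neq0.
pose D := c * (x - a * r - r) - 2 * b ^+ 2 * r.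
have D0 : D != 0.
  have -> : D = (rvar - rconst (2 * alpha + alpha * n2%:R))
      * (rvar - rconst (alpha * r1%:R + r1%:R)) - rconst (2 * (1 - alpha) ^+ 2 * r1%:R).
    rewrite -cE rmorphD !rmorphM rmorphB rmorph1 !rmorph_nat.
    by rewrite /D expr2 opprD addrA.
  exact: rvar_quadratic_neq0.
have n1_gt0 : (0 < n1)%N by case: conn1 => + _; rewrite En1.
have size_l : size lambda = n1 by rewrite (spectrum_size lambdaP).
have l0 : lambda`_0 = r1%:R.
  apply: spectrum_head lambdaP; rewrite ?En1 // => *; first exact: Aalpha_ge0.
  exact: Aalpha_colsum.
have xm_unit : (x - a * m)%:M - map_mx (@rconst R) (Aalpha alpha G2) \in unitmx.
  by rewrite /a /m -(rmorph_nat (@rconst R)) -rmorphM charmx_unit.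
rewrite (psi_ejoin _ _ _ reg1) -/a -/r -/b.
have -> : #|edges G1|%:R = m by rewrite Em1.
have -> : #|vertex G2|%:R = n by rewrite En2.
rewrite -/c.
rewrite (det_two_join xm_unit c0 D0 (charmx_Aalpha_one alpha _ reg1)
  (incmx_one _ reg1) (incmxT_one _ _)).
rewrite (incmx_tr_regular _ reg1).
rewrite (det_shifted_gram _ cb0 (map_Aalpha_regular _ reg1)
  (s := [seq rconst z | z <- lambda])); first last.
- by move=> z; rewrite big_map (det_map_split (@rconst R) _ (proj2 lambdaP)).
- by rewrite size_map size_l.
(* Index 0, the eigenvalue [r1], is split off; indices from 1 below [n1] are the second to the last
   eigenvalue. *)
rewrite big_map (big_nth 0) size_l (big_ltn n1_gt0) l0 rmorph_nat -/r.
have -> : (c * (x - a * r - r) - b ^+ 2 * r + a * b * r - b * r) = D.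
  exact: principal_quadraticE.
have -> : #|edge G1| = m1 by rewrite card_edge_type.
(* As [c] is nonzero, the quotient is one integer power, even for a negative exponent. *)
have expE : c ^+ m1 / c ^+ #|vertex G1| = c ^ (m1%:Z - n1%:Z).
  by rewrite (expfzDr _ _ c0) -exprnN En1.
rewrite expE -/m trmx_const.
apply: etrans (mulr_regroup _ _ _ _ _) _; congr (_ * _ * _).
  by apply: eq_bigr => i _; apply: quadraticE.
exact: principal_factorE D0.
Qed.
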